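(* Consider one step $i$ of a memory-augmented recurrent neural network with vanilla (linear-activation) transition, in which the previous hidden state $\bm h_{i-1}$ and the current input $\bm x_i$ are held fixed. The hidden state is $\bm h_i = W \bm h_{i-1} + U \bm x_i + W_{(c)} \bm c + \bm b \in \mathbb{R}^D$, where $\bm c \in \mathbb{R}^d$ is the memory content retrieved from a key-value memory bank with $N$ slots: $\widetilde\alpha_j = \exp\{\bm h_{i-1}^\top \bm m_j^{(\mathrm{key})}\}$, $\alpha_j = \widetilde\alpha_j / \sum_{j'=1}^N \widetilde\alpha_{j'}$, and $\bm c = \sum_{j=1}^N \alpha_j \bm m_j^{(\mathrm{val})}$, with $\bm m_j^{(\mathrm{val})}\in\mathbb{R}^d$. Compare two ways of increasing model capacity: (i) Memory expansion: $M$ new slots $j=N+1,\dots,N+M$ (with keys and values $\bm m_j^{(\mathrm{val})}\in\mathbb{R}^d$) are added, the attention becomes $\alpha'_j = \widetilde\alpha_j / \sum_{j'=1}^{N+M}\widetilde\alpha_{j'}$ for $1\le j\le N+M$, the content becomes $\bm c' = \sum_{j=1}^{N+M}\alpha'_j \bm m_j^{(\mathrm{val})}$, and all other quantities are unchanged, giving $\bm h_i^{(m)} = W \bm h_{i-1} + U \bm x_i + W_{(c)} \bm c' + \bm b$. (ii) Hidden-state expansion: $d$ new hidden units are added, with values $\widetilde{\bm h}_{i-1}\in\mathbb{R}^d$ at step $i-1$, connected to the original $D$ dimensions by new weights $\widetilde W\in\mathbb{R}^{D\times d}$; the original $D$ dimensions of the new hidden state at step $i$ are $\bm h_i^{(s)}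 = \bm h_i + \widetilde W \widetilde{\bm h}_{i-1}$. Suppose that, for the given data point, the unnormalized attention weights satisfy $\sum_{j=N+1}^{N+M}\widetilde\alpha_j \le \sum_{j=1}^{N}\widetilde\alpha_j$. Then $$\mathbb{E}\left[\|\bm h_i^{(m)}-\bm h_i\|^2\right] \le \mathbb{E}\left[\|\bm h_i^{(s)}-\bm h_i\|^2\right],$$ where the expectation is computed by assuming the weights and hidden states (the entries of $\widetilde W$, $\widetilde{\bm h}_{i-1}$, $W_{(c)}$, and all memory value vectors $\bm m_j^{(\mathrm{val})}$, $1\le j\le N+M$) are i.i.d. from a zero-mean Gaussian distribution with variance $\sigma^2$ (independent of the attention weights).
   Context: This is a simplified model of a recurrent neural network augmented with a key-value memory bank retrieved by softmax attention, used to compare the perturbation of the original $D$ hidden dimensions caused by adding memory slots versus adding hidden units. The attention weights $\widetilde\alpha_j$ for a given data point are treated as fixed (they depend on the keys and on $\bm h_{i-1}$, which is fixed), while the randomness is over the weights, the newly added hidden units, and the memory value entries, all i.i.d. zero-mean Gaussian with variance $\sigma^2$. *)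

(* Defs.v *)
From HB Require Import structures.
From mathcomp Require Import all_boot all_order all_algebra.
From mathcomp Require Import all_classical all_reals all_analysis.
Set Implicit Arguments. Unset Strict Implicit. Unset Printing Implicit Defensive.
Import Order.TTheory GRing.Theory Num.Theory.
Local Open Scope classical_set_scope.
Local Open Scope ring_scope.

Definition sqnorm {R : realType} {n : nat} (v : 'cV[R]_n) : R :=
  \sum_(l < n) (v l 0) ^+ 2.

Definition att_tilde {R : realType} {D : nat} (h : 'cV[R]_D) (key : 'cV[R]_D) : R :=
  expR ((h^T *m key) 0 0).

(* memory mem_content read using only the first n slots (n = N: original bank,
   n = N+M: expanded bank):  sum_{j<n} (at_j / sum_{j'<n} at_j') m_j *)
Definition mem_content {R : realType} {K d : nat} (n : nat) (aw : 'I_K -> R)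
    (mval : 'I_K -> 'cV[R]_d) : 'cV[R]_d :=
  \sum_(j < K | (j < n)%N) (aw j / \sum_(j' < K | (j' < n)%N) aw j') *: mval j.

Definition rnn_step {R : realType} {D p d : nat} (W : 'M[R]_D) (U : 'M[R]_(D, p))
    (Wc : 'M[R]_(D, d)) (b : 'cV[R]_D) (h : 'cV[R]_D) (x : 'cV[R]_p)
    (c : 'cV[R]_d) : 'cV[R]_D :=
  W *m h + U *m x + Wc *m c + b.

Definition mutually_independent {dT : measure_display} {T : measurableType dT}
    {R : realType} (P : probability T R) {I : finType} (X : I -> T -> R) : Prop :=
  forall (J : {set I}) (B : I -> set R), (forall i, measurable (B i)) ->
    P [set w | forall i, i \in J -> B i (X i w)] =
    (\prod_(i in J) P (X i @^-1` B i))%E.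

Definition gaussian_rv {dT : measure_display} {T : measurableType dT}
    {R : realType} (P : probability T R) (sigma : R) (X : T -> R) : Prop :=
  measurable_fun setT X /\
  forall B : set R, measurable B -> P (X @^-1` B) = normal_prob 0 sigma B.

Definition rand_idx (D d K : nat) : finType :=
  (((('I_D * 'I_d) + 'I_d) + ('I_D * 'I_d)) + ('I_K * 'I_d))%type.

Definition all_entries {T : Type} {R : Type} {D d K : nat}
    (Wt : 'I_D -> 'I_d -> T -> R) (ht : 'I_d -> T -> R)
    (Wc : 'I_D -> 'I_d -> T -> R) (mv : 'I_K -> 'I_d -> T -> R)
    (i : rand_idx D d K) : T -> R :=
  match i with
  | inl (inl (inl (l, k))) => Wt l k
  | inl (inl (inr k)) => ht k
  | inl (inr (l, k)) => Wc l k
  | inr (j, k) => mv j k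
  end.

(* Main.v *)
(* Write [beta] for the change of the attention weights, so that
   [h_m - h_i = sum_j beta_j W_(c) m_j].  The hypothesis gives
   [sum_j |beta_j| <= 1], hence by convexity of the square each coordinate of
   [h_m - h_i] has square at most [sum_j |beta_j| (W_(c) m_j)_l ^ 2].  Each
   [(W_(c) m_j)_l] has the same law as [(Wt ht)_l], because both are the same
   function of [2 d] independent variables with a common law.  No moment of the
   Gaussian distribution has to be computed. *)
Require Import Defs.
From HB Require Import structures.
From mathcomp Require Import all_boot all_order all_algebra.
From mathcomp Require Import all_classical all_reals all_analysis.
From mathcomp Require Import measurable_realfun ring lra.
Import Order.TTheory GRing.Theory Num.Theory.
Local Open Scope classical_set_scope.
Local Open Scope ring_scope.

(* A copy of [K -> R] on which a pointed structure, required by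
   [g_sigma_algebraType], can be inferred. *)
Definition real_family (R : realType) (K : Type) : Type := K -> R.
HB.instance Definition _ (R : realType) K := gen_eqMixin (real_family R K).
HB.instance Definition _ (R : realType) K := gen_choiceMixin (real_family R K).
HB.instance Definition _ (R : realType) K :=
  isPointed.Build (real_family R K) (fun=> 0).

(** * Joint law of a finite independent family, on the product sigma-algebra *)

Section law_of_independent_family.
Context {dT : measure_display} {T : measurableType dT} {R : realType}.
Variable P : probability T R.

(** Boxes restrict every coordinate at once, so they are stable under intersection: a pi-system
    generating the product sigma-algebra. *)
Definition cylinders (K : Type) : set (set (real_family R K)) :=
  [set [set v : real_family R K | forall k, B k (v k)] |
    B in [set B : K -> set R | forall k, measurable (B k)]].

Lemma setI_closed_cylinders (K : Type) : setI_closed (@cylinders K).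
Proof.
move=> _ _ [B mB <-] [C mC <-]; exists (fun k => B k `&` C k).
  by move=> k; apply: measurableI; [exact: mB|exact: mC].
apply/seteqP; split=> v /=.
  by move=> BCv; split=> k; have [] := BCv k.
by move=> [Bv Cv] k; split; [exact: Bv|exact: Cv].
Qed.

Lemma cylindersT (K : Type) : @cylinders K setT.
Proof. by exists (fun=> setT) => //; apply/seteqP; split. Qed.

Lemma measurable_coord (K : Type) (k : K) :
  measurable_fun setT (fun v : g_sigma_algebraType (@cylinders K) => v k).
Proof.
move=> _ B mB; rewrite setTI; apply: sub_sigma_algebra.
(* The box with side [B] at [k] and the full line elsewhere; the implication avoids deciding
   equality on the arbitrary type [K]. *)
exists (fun k' => [set x | k' = k -> B x]).
  move=> k'; have [->|k'k] := pselect (k' = k).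
    by rewrite (_ : [set x | _] = B)//; apply/seteqP; split=> x /= => [/(_ erefl)|].
  by rewrite (_ : [set x | _] = setT)//; apply/seteqP; split=> x // _ /k'k.
by apply/seteqP; split=> v /= => [/(_ k erefl)|Bv k' ->].
Qed.

Lemma measurable_cylinder (K : finType) (X : K -> T -> R) (B : K -> set R) :
  (forall k, measurable_fun setT (X k)) -> (forall k, measurable (B k)) ->
  measurable [set w | forall k, B k (X k w)].
Proof.
move=> mX mB.
rewrite (_ : [set w | _] = \bigcap_(k in [set: K]) (X k @^-1` B k)); last first.
  by apply/seteqP; split=> w /= => [Bw k _|Bw k]; [exact: Bw|exact: Bw k I].
apply: fin_bigcap_measurable => // k _.
by rewrite -[X in measurable X]setTI; exact: mX.
Qed.

Lemma measurable_family (K : finType) (X : K -> T -> R) :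
  (forall k, measurable_fun setT (X k)) ->
  measurable_fun setT
    (fun w => (fun k => X k w) : g_sigma_algebraType (@cylinders K)).
Proof.
move=> mX; apply: (@measurability _ _ T (g_sigma_algebraType (@cylinders K)) setT _
  (@cylinders K)) => // _ [_ [B mB <-] <-].
by rewrite setTI; exact: measurable_cylinder.
Qed.

(** Independence is applied to the image of [f]; injectivity turns the product over that image into
    one over [K]. *)
Lemma mutually_independent_inj (I K : finType) (X : I -> T -> R)
    (f : K -> I) (B : K -> set R) :
  injective f -> mutually_independent P X -> (forall k, measurable (B k)) ->
  P [set w | forall k, B k (X (f k) w)] = (\prod_k P (X (f k) @^-1` B k))%E.
Proof.
move=> f_inj indX mB.
(* [C] transports [B] along [f]; its value off the image is irrelevant. *)
pose C i := if [pick k | f k == i] is Some k then B k else setT.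
have Cf k : C (f k) = B k.
  rewrite /C; case: pickP => [k' /eqP/f_inj->//|/(_ k)].
  by rewrite eqxx.
have mC i : measurable (C i) by rewrite /C; case: pickP.
have := indX [set i in codom f]%SET C mC.
rewrite (_ : [set w | _] = [set w | forall k, B k (X (f k) w)]); last first.
  apply/seteqP; split=> w /= Bw.
    by move=> k; rewrite -Cf; apply: Bw; rewrite inE codom_f.
  by move=> i; rewrite inE => /codomP[k ->]; rewrite Cf.
move=> ->.
rewrite (eq_bigl (mem (f @: K)%SET)); last first.
  move=> i; rewrite !inE; apply/codomP/imsetP => -[k].
    by move=> ->; exists k.
  by move=> _ ->; exists k.
rewrite big_imset /=; last by move=> ? ? _ _ /f_inj.
by under eq_bigr do rewrite Cf; apply: eq_bigl => k; rewrite inE.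
Qed.

(** Both subfamilies give a box the same product of marginal probabilities, so their joint laws
    coincide by uniqueness on a pi-system, and the integral of [phi] depends on the law alone. Since
    [phi] is nonnegative, no integrability is required. *)
Lemma ge0_integral_subfamily (I K : finType) (X : I -> T -> R) (f g : K -> I)
    (phi : real_family R K -> R) :
  mutually_independent P X -> (forall i, measurable_fun setT (X i)) ->
  (forall i j B, measurable B -> P (X i @^-1` B) = P (X j @^-1` B)) ->
  injective f -> injective g -> (forall v, 0 <= phi v) ->
  measurable_fun setT (phi : g_sigma_algebraType (@cylinders K) -> R) ->
  (\int[P]_w (phi (fun k => X (f k) w))%:E =
   \int[P]_w (phi (fun k => X (g k) w))%:E)%E.
Proof.
move=> indX mX eqX f_inj g_inj phi0 mphi.
have mfam (h : K -> I) := measurable_family _ (fun k => X (h k)) (fun k => mX (h k)).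
have law (h : K -> I) : (\int[P]_w (phi (fun k => X (h k) w))%:E =
    \int[pushforward P (fun w => (fun k => X (h k) w)
      : g_sigma_algebraType (@cylinders K))]_v (phi v)%:E)%E.
  rewrite ge0_integral_pushforward//=.
  - exact/measurable_EFinP.
  - by move=> v _; rewrite lee_fin.
rewrite !law; apply: eq_measure_integral.
move=> A mA _.
(* The laws are finite measures, so the constant sequence [setT] serves as the exhausting cover. *)
apply: (@measure_unique _ R (g_sigma_algebraType (@cylinders K))
  (@cylinders K) (fun=> setT)) => //.
- exact: setI_closed_cylinders.
- by move=> _; exact: cylindersT.
- by rewrite bigcup_const.
- move=> _ [B mB <-]; rewrite /= /pushforward /=.
  rewrite [LHS](mutually_independent_inj I K X f B)//.
  rewrite [RHS](mutually_independent_inj I K X g B)//.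
  by apply: eq_bigr => k _; exact: eqX.
- by move=> _; rewrite /= /pushforward preimage_setT probability_setT ltry.
Qed.

End law_of_independent_family.

(** Jensen's inequality with signed weights. With [s] the sum on the left, expanding the nonnegative
    sum of [|b i| * (y i - sg (b i) * s) ^+ 2] leaves the right-hand side plus
    [(\sum_i |b i| - 2) * s ^+ 2], whose coefficient is at most [-1]. *)
Lemma sqr_sum_le_weighted (R : realFieldType) (I : finType) (b y : I -> R) :
  \sum_i `|b i| <= 1 -> (\sum_i b i * y i) ^+ 2 <= \sum_i `|b i| * y i ^+ 2.
Proof.
move=> b1; set s := \sum_i b i * y i.
have : 0 <= \sum_i `|b i| * (y i - Num.sg (b i) * s) ^+ 2.
  by apply: sumr_ge0 => i _; rewrite mulr_ge0// sqr_ge0.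
have -> : \sum_i `|b i| * (y i - Num.sg (b i) * s) ^+ 2 =
    \sum_i `|b i| * y i ^+ 2 - 2 * s ^+ 2 + (\sum_i `|b i|) * s ^+ 2.
  have -> : 2 * s ^+ 2 = \sum_i 2 * s * (b i * y i).
    by rewrite -mulr_sumr -/s expr2 mulrA.
  rewrite mulr_suml -sumrB -big_split /=; apply: eq_bigr => i _.
  (* A zero weight is treated apart because its sign squares to 0 instead of 1. *)
  have [->|b0] := eqVneq (b i) 0; first by rewrite normr0; ring.
  have sg2 : Num.sg (b i) ^+ 2 = 1 by rewrite sqr_sg b0.
  have bE : `|b i| * Num.sg (b i) = b i by rewrite mulrC -numEsg.
  by rewrite -[in X in _ - X + _]bE sqrrB exprMn sg2; ring.
have := sqr_ge0 s; nra.
Qed.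

(** * Total variation of the change of the attention weights *)

Section attention_change.
Context {R : realType} (N M : nat).
Variable a : 'I_(N + M) -> R.
Local Notation old := (\sum_(j < N + M | (j < N)%N) a j).
Local Notation new := (\sum_(j < N + M | (N <= j)%N) a j).

Definition att_change (j : 'I_(N + M)) : R :=
  a j / (\sum_(j' < N + M) a j') - (if (j < N)%N then a j / old else 0).

Lemma mem_content_change (d : nat) (m : 'I_(N + M) -> 'cV[R]_d) :
  mem_content (N + M) a m - mem_content N a m = \sum_j att_change j *: m j.
Proof.
rewrite /mem_content (eq_bigl predT); last by move=> j; rewrite ltn_ord.
rewrite [X in _ - X]big_mkcond -sumrB; apply: eq_bigr => j _.
rewrite (eq_bigl predT); last by move=> j'; rewrite ltn_ord.
by rewrite /att_change scalerBl; case: ifP => // _; rewrite scale0r.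
Qed.

(* The total variation is [2 * new / (old + new)]; when there is no old weight
   it is [0], since division by [0] gives [0]. *)
Lemma sum_norm_att_change : (forall j, 0 <= a j) -> new <= old ->
  \sum_j `|att_change j| <= 1.
Proof.
move=> a0 new_le_old.
have totE : \sum_j a j = old + new.
  rewrite [LHS](bigID (fun j : 'I_(N + M) => (j < N)%N)) /=; congr (_ + _).
  by apply: eq_bigl => j; rewrite -leqNgt.
have new0 : 0 <= new by apply: sumr_ge0.
have old0 : 0 <= old by apply: sumr_ge0.
rewrite (bigID (fun j : 'I_(N + M) => (j < N)%N)) /=.
have [oldz|oldn0] := eqVneq old 0.
  have newz : new = 0 by apply/eqP; rewrite eq_le new0 andbT -[leRHS]oldz.
  have change0 j : att_change j = 0.
    by rewrite /att_change totE oldz newz addr0 invr0 !mulr0 if_same subrr.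
  by rewrite !big1 ?addr0// => j _; rewrite change0 normr0.
have old_gt0 : 0 < old by rewrite lt_neqAle eq_sym oldn0.
have tot_gt0 : 0 < old + new by rewrite ltr_wpDr.
(* Enlarging the denominator lowers every old weight, which settles the sign inside the absolute
   value. *)
have -> : \sum_(j < N + M | (j < N)%N) `|att_change j| =
    old * (old^-1 - (old + new)^-1).
  rewrite mulr_suml; apply: eq_bigr => j jN.
  rewrite /att_change jN totE -mulrBr normrM ger0_norm// distrC ger0_norm//.
  by rewrite subr_ge0 lef_pV2 ?posrE// lerDl.
have -> : \sum_(j < N + M | ~~ (j < N)%N) `|att_change j| =
    new * (old + new)^-1.
  rewrite mulr_suml; apply: eq_big => j; first by rewrite -leqNgt.
  move=> /negbTE jN; rewrite /att_change jN totE subr0 ger0_norm//.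
  by rewrite mulr_ge0// invr_ge0 ltW.
(* The two parts add up to [1 + (new - old) / (old + new)]. *)
rewrite mulrBr divff// -addrA gerDl addrC -mulrBl.
by rewrite mulr_le0_ge0 ?invr_ge0 ?(ltW tot_gt0)// subr_le0.
Qed.

End attention_change.

Theorem theorem1 (R : realType) (dT : measure_display) (T : measurableType dT)
    (P : probability T R) (sigma : R) (D d p N M : nat)
    (W : 'M[R]_D) (U : 'M[R]_(D, p)) (b : 'cV[R]_D)
    (h_prev : 'cV[R]_D) (x : 'cV[R]_p) (keys : 'I_(N + M) -> 'cV[R]_D)
    (Wt : 'I_D -> 'I_d -> T -> R) (ht : 'I_d -> T -> R)
    (Wc : 'I_D -> 'I_d -> T -> R) (mval : 'I_(N + M) -> 'I_d -> T -> R) :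
  sigma != 0 ->
  mutually_independent P (all_entries Wt ht Wc mval) ->
  (forall i, gaussian_rv P sigma (all_entries Wt ht Wc mval i)) ->
  let aw := fun j : 'I_(N + M) => att_tilde h_prev (keys j) in
  \sum_(j < N + M | (N <= j)%N) aw j <= \sum_(j < N + M | (j < N)%N) aw j ->
  let Wc_ w := \matrix_(l < D, k < d) Wc l k w in
  let m_ w := fun j => \col_(k < d) mval j k w in
  let h_i w := rnn_step W U (Wc_ w) b h_prev x (mem_content N aw (m_ w)) in
  let h_m w := rnn_step W U (Wc_ w) b h_prev x (mem_content (N + M) aw (m_ w)) in
  let h_s w := h_i w + (\matrix_(l < D, k < d) Wt l k w) *m (\col_(k < d) ht k w) in
  ('E_P[fun w => sqnorm (h_m w - h_i w)] <= 'E_P[fun w => sqnorm (h_s w - h_i w)])%E.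
Proof.
move=> _ indep gauss aw new_le_old.
pose Wc_ w := \matrix_(l < D, k < d) Wc l k w.
pose m_ w := fun j => \col_(k < d) mval j k w.
pose h_i w := rnn_step W U (Wc_ w) b h_prev x (mem_content N aw (m_ w)).
pose h_m w := rnn_step W U (Wc_ w) b h_prev x (mem_content (N + M) aw (m_ w)).
pose h_s w :=
  h_i w + (\matrix_(l < D, k < d) Wt l k w) *m (\col_(k < d) ht k w).
change ('E_P[fun w => sqnorm (h_m w - h_i w)] <=
        'E_P[fun w => sqnorm (h_s w - h_i w)])%E.
set X := all_entries Wt ht Wc mval in indep gauss.
have mX i : measurable_fun setT (X i) by have [] := gauss i.
have eqX i j B : measurable B -> P (X i @^-1` B) = P (X j @^-1` B).
  by move=> mB; rewrite (gauss i).2// (gauss j).2.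
pose beta := att_change N M aw.
have beta1 : \sum_j `|beta j| <= 1.
  by apply: sum_norm_att_change => // j; exact: expR_ge0.
(* [Y l j] is coordinate [l] of [W_(c) m_j], and [Z l] is coordinate [l] of the contribution of the
   new hidden units. *)
pose Y l j w := \sum_k Wc l k w * mval j k w.
pose Z l w := \sum_k Wt l k w * ht k w.
have mY l j : measurable_fun setT (Y l j).
  apply: measurable_sum => k; apply: measurable_funM.
    exact: (mX (inl (inr (l, k)))).
  exact: (mX (inr (j, k))).
have mZ l : measurable_fun setT (Z l).
  apply: measurable_sum => k; apply: measurable_funM.
    exact: (mX (inl (inl (inl (l, k))))).
  exact: (mX (inl (inl (inr k)))).
have mY2 l j : measurable_fun setT (fun w => (Y l j w ^+ 2)%:E).
  by apply/measurable_EFinP; exact: measurable_funX.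
have mZ2 l : measurable_fun setT (fun w => (Z l w ^+ 2)%:E).
  by apply/measurable_EFinP; exact: measurable_funX.
have hsE w : sqnorm (h_s w - h_i w) = \sum_l Z l w ^+ 2.
  rewrite /h_s addrC addKr; apply: eq_bigr => l _; rewrite mxE.
  by congr (_ ^+ 2); apply: eq_bigr => k _; rewrite !mxE.
have hmE w : sqnorm (h_m w - h_i w) = \sum_l (\sum_j beta j * Y l j w) ^+ 2.
  rewrite /h_m /h_i /rnn_step opprD addrACA subrr addr0 opprD addrACA subrr add0r.
  rewrite -mulmxBr mem_content_change.
  apply: eq_bigr => l _; congr (_ ^+ 2); rewrite mxE.
  under eq_bigr do rewrite summxE mulr_sumr.
  rewrite exchange_big; apply: eq_bigr => j _; rewrite mulr_sumr.
  by apply: eq_bigr => k _; rewrite !mxE mulrCA.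
have EY l j : (\int[P]_w (Y l j w ^+ 2)%:E = \int[P]_w (Z l w ^+ 2)%:E)%E.
  (* The left summand indexes row [l] of the matrix and the right one the entries of the vector, so
     [Y l j] and [Z l] are the same pairing read through [f] and [g]. *)
  pose f (k : 'I_d + 'I_d) : rand_idx D d (N + M) :=
    match k with inl k => inl (inr (l, k)) | inr k => inr (j, k) end.
  pose g (k : 'I_d + 'I_d) : rand_idx D d (N + M) :=
    match k with inl k => inl (inl (inl (l, k))) | inr k => inl (inl (inr k)) end.
  apply: (ge0_integral_subfamily P _ _ X f g
    (fun v => (\sum_k v (inl k) * v (inr k)) ^+ 2)) => //.
  - by move=> [k|k] [k'|k'] //= [->].
  - by move=> [k|k] [k'|k'] //= [->].
  - by move=> v; exact: sqr_ge0.
  - apply: measurable_funX; apply: measurable_sum => k.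
    by apply: measurable_funM; exact: measurable_coord.
rewrite unlock.
under eq_integral do rewrite hmE.
under [leRHS]eq_integral do rewrite hsE -sumEFin.
rewrite ge0_integral_sum//; last by move=> l w _; rewrite lee_fin sqr_ge0.
(* The convexity bound is applied pointwise; all terms are nonnegative, so sums and integrals
   commute in the extended reals. *)
apply: (@le_trans _ _
    (\int[P]_w \sum_l \sum_j (`|beta j|%:E * (Y l j w ^+ 2)%:E))%E).
  apply: ge0_le_integral => //.
  - by move=> w _; rewrite lee_fin sumr_ge0// => l _; exact: sqr_ge0.
  - apply/measurable_EFinP; apply: measurable_sum => l.
    apply: measurable_funX; apply: measurable_sum => j.
    exact: measurable_funM.
  - apply: emeasurable_sum => l; apply: emeasurable_sum => j.
    exact: measurable_funeM.
  - move=> w _; rewrite -sumEFin; apply: lee_sum => l _.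
    rewrite sumEFin lee_fin; exact: sqr_sum_le_weighted.
rewrite ge0_integral_sum//; last 2 first.
- by move=> l; apply: emeasurable_sum => j; exact: measurable_funeM.
- by move=> l w _; apply: sume_ge0 => j _; rewrite -EFinM lee_fin mulr_ge0// sqr_ge0.
apply: lee_sum => l _; rewrite ge0_integral_sum//; last 2 first.
- by move=> j; exact: measurable_funeM.
- by move=> j w _; rewrite -EFinM lee_fin mulr_ge0// sqr_ge0.
under eq_bigr => j _.
  rewrite ge0_integralZl_EFin//; last by move=> w _; rewrite lee_fin sqr_ge0.
  rewrite EY; over.
rewrite -ge0_sume_distrl; last by move=> j _; rewrite lee_fin.
(* Only the factor [\sum_j |beta j|] has to be finite here: the second moment of [Z l] may be any
   nonnegative extended real. *)
rewrite sumEFin; apply: gee_pMl.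
- by [].
- by apply: integral_ge0 => w _; rewrite lee_fin sqr_ge0.
- by rewrite lee_fin.
Qed.
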